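(* For every integer $k\geq 1$, $$ \zeta(2k+1) - \frac{2^{2k-1} |E_{2k}| }{(2k)!} \pi^{2k+1} = \sum_{n\geq1} \frac{N(n;k)}{n^{2k+1}}, $$ where $$ N(n;k) = (2^{4k+1} - 2^{2k}) (2 b_n -1) + 2^{-(2k+1)} \left((2^{2k+1}+1) t_{n-1} + (2^{2k+1}-1) t_n\right). $$
   Context: $\zeta(s)=\sum_{n\ge1} n^{-s}$ is the Riemann zeta function. $(t_n)_{n\geq0}$ is the Thue–Morse sequence, defined by $t_0=0$, $t_{2n}=t_n$, $t_{2n+1}=1-t_n$ (so it begins $0,1,1,0,1,0,0,1,\dots$). $(b_n)_{n\geq1}$ is the paperfolding sequence, defined by $b_{2n}=b_n$, $b_{4n+1}=0$, $b_{4n+3}=1$ for $n\ge 0$ (so it begins $0,0,1,0,0,1,1,0,\dots$). $E_k$ denotes the $k$-th Euler number, defined by $\frac{1}{\cosh t}=\sum_{k\geq0}\frac{E_k}{k!}t^k$. *)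

(* Defs.v *)
From Stdlib Require Import Reals ZArith Lia Lra.
From Coquelicot Require Import Coquelicot.
Open Scope R_scope.

(* Only meaningful for s > 1, where the series converges. *)
Definition zeta (s : R) : R := Series (fun n : nat => / Rpower (INR (S n)) s).

Definition is_thue_morse (t : nat -> Z) : Prop :=
  t 0%nat = 0%Z /\
  (forall n : nat, t (2 * n)%nat = t n) /\
  (forall n : nat, t (2 * n + 1)%nat = (1 - t n)%Z).

(* The sequence is indexed from 1: b 0 is left unconstrained and is never used. *)
Definition is_paperfolding (b : nat -> Z) : Prop :=
  (forall n : nat, (1 <= n)%nat -> b (2 * n)%nat = b n) /\
  (forall n : nat, b (4 * n + 1)%nat = 0%Z) /\
  (forall n : nat, b (4 * n + 3)%nat = 1%Z).

(* The expansion of 1 / cosh is required on some neighbourhood of 0. *)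
Definition is_euler_numbers (E : nat -> R) : Prop :=
  locally 0 (fun x : R => is_pseries (fun k : nat => E k / INR (fact k)) x (/ cosh x)).

Definition N_coef (t b : nat -> Z) (n k : nat) : R :=
  (2 ^ (4 * k + 1) - 2 ^ (2 * k)) * (2 * IZR (b n) - 1)
  + / 2 ^ (2 * k + 1) *
    ((2 ^ (2 * k + 1) + 1) * IZR (t (n - 1)%nat)
     + (2 ^ (2 * k + 1) - 1) * IZR (t n)).

(* Each of the three predicates above determines its sequence uniquely (for the
   paperfolding sequence, on indices n >= 1). *)

Fixpoint tm_pos (p : positive) : Z :=
  match p with
  | xH => 1
  | xO q => tm_pos q
  | xI q => 1 - tm_pos q
  end.

Lemma thue_morse_exists : exists t, is_thue_morse t.
Proof.
exists (fun n => match N.of_nat n with N0 => 0%Z | Npos p => tm_pos p end).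
split; [reflexivity|split]; intros n.
- replace (N.of_nat (2 * n)) with (N.double (N.of_nat n)) by lia.
  now destruct (N.of_nat n).
- replace (N.of_nat (2 * n + 1)) with (N.succ_double (N.of_nat n)) by lia.
  now destruct (N.of_nat n).
Qed.

Lemma thue_morse_unique t t' :
  is_thue_morse t -> is_thue_morse t' -> forall n, t n = t' n.
Proof.
intros [H0 [H1 H2]] [K0 [K1 K2]] n.
induction n as [n IH] using (well_founded_induction Wf_nat.lt_wf).
destruct (Nat.Even_or_Odd n) as [[m ->]|[m ->]].
- destruct m as [|m]; [simpl; congruence|].
  rewrite H1, K1; apply IH; lia.
- rewrite H2, K2, IH; [reflexivity|lia].
Qed.

Fixpoint pf_pos (p : positive) : Z :=
  match p with
  | xH => 0
  | xO q => pf_pos q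
  | xI (xO _) => 0
  | xI _ => 1
  end.

Lemma paperfolding_exists : exists b, is_paperfolding b.
Proof.
exists (fun n => match N.of_nat n with N0 => 0%Z | Npos p => pf_pos p end).
split; [|split]; intros n.
- intros _; replace (N.of_nat (2 * n)) with (N.double (N.of_nat n)) by lia.
  now destruct (N.of_nat n).
- replace (N.of_nat (4 * n + 1)) with (N.succ_double (N.double (N.of_nat n))) by lia.
  now destruct (N.of_nat n).
- replace (N.of_nat (4 * n + 3))
    with (N.succ_double (N.succ_double (N.of_nat n))) by lia.
  now destruct (N.of_nat n).
Qed.

Lemma paperfolding_unique b b' :
  is_paperfolding b -> is_paperfolding b' ->
  forall n, (1 <= n)%nat -> b n = b' n.
Proof.
intros [H0 [H1 H2]] [K0 [K1 K2]] n.
induction n as [n IH] using (well_founded_induction Wf_nat.lt_wf); intros Hn.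
destruct (Nat.Even_or_Odd n) as [[m ->]|[m ->]].
- rewrite H0, K0 by lia; apply IH; lia.
- destruct (Nat.Even_or_Odd m) as [[l ->]|[l ->]].
  + replace (2 * (2 * l) + 1)%nat with (4 * l + 1)%nat by lia; congruence.
  + replace (2 * (2 * l + 1) + 1)%nat with (4 * l + 3)%nat by lia; congruence.
Qed.

(* Existence of the Euler numbers: the reciprocal of the power series of cosh,
   with coefficients bounded by 2 ^ n. *)

Definition cosh_coef (n : nat) : R := (1 + (-1) ^ n) / 2 * / INR (fact n).

Fixpoint recip_prefix (n : nat) : nat -> R :=
  match n with
  | O => fun _ => 1
  | S n' => fun m =>
      if Nat.leb m n' then recip_prefix n' m
      else - sum_f_R0 (fun j => cosh_coef (S j) * recip_prefix n' (n' - j)%nat) n'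
  end.

Definition recip_coef (n : nat) : R := recip_prefix n n.

Lemma recip_prefix_le n m : (m <= n)%nat -> recip_prefix n m = recip_coef m.
Proof.
induction n as [|n IH]; intros H.
- now replace m with 0%nat by lia.
- destruct (Nat.eq_dec m (S n)) as [->|Hm]; [reflexivity|].
  simpl; rewrite (proj2 (Nat.leb_le m n)) by lia.
  apply IH; lia.
Qed.

Lemma recip_coef_S n :
  recip_coef (S n) = - sum_f_R0 (fun j => cosh_coef (S j) * recip_coef (n - j)%nat) n.
Proof.
unfold recip_coef at 1; cbn [recip_prefix].
rewrite (proj2 (Nat.leb_gt (S n) n)) by lia.
f_equal; apply sum_eq; intros j Hj.
now rewrite recip_prefix_le by lia.
Qed.

Lemma cosh_coef_bound n : Rabs (cosh_coef n) <= 1.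
Proof.
assert (H1 : 1 <= INR (fact n)).
{ apply (le_INR 1); generalize (lt_O_fact n); lia. }
assert (H2 : / INR (fact n) <= 1).
{ rewrite <- Rinv_1; apply Rinv_le_contravar; lra. }
assert (H3 : 0 < / INR (fact n)) by (apply Rinv_0_lt_compat; lra).
assert (H4 : Rabs ((1 + (-1) ^ n) / 2) <= 1).
{ assert (H := pow_1_abs n).
  apply Rabs_le; destruct (Rabs_le_between ((-1) ^ n) 1) as [K _].
  specialize (K (Req_le _ _ H)); lra. }
unfold cosh_coef; rewrite Rabs_mult, (Rabs_pos_eq (/ _)) by lra.
generalize (Rabs_pos ((1 + (-1) ^ n) / 2)); nra.
Qed.

Lemma recip_coef_bound n : Rabs (recip_coef n) <= 2 ^ n.
Proof.
induction n as [n IH] using (well_founded_induction Wf_nat.lt_wf).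
destruct n as [|n].
- unfold recip_coef; simpl; rewrite Rabs_R1; lra.
- rewrite recip_coef_S, Rabs_Ropp.
  apply Rle_trans with (1 := Rsum_abs _ _).
  apply Rle_trans with (sum_f_R0 (fun j => 2 ^ (n - j)) n).
  + apply sum_Rle; intros j Hj; rewrite Rabs_mult.
    assert (H1 := cosh_coef_bound (S j)).
    assert (H2 : Rabs (recip_coef (n - j)) <= 2 ^ (n - j)) by (apply IH; lia).
    generalize (Rabs_pos (cosh_coef (S j))) (Rabs_pos (recip_coef (n - j))); nra.
  + clear IH; assert (H : sum_f_R0 (fun j => 2 ^ (n - j)) n = 2 ^ S n - 1).
    { induction n as [|n IHn]; [simpl; lra|].
      rewrite decomp_sum by lia.
      replace (pred (S n)) with n by lia.
      rewrite (sum_eq _ (fun j => 2 ^ (n - j))); [|intros; f_equal; lia].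
      rewrite IHn; replace (S n - 0)%nat with (S n) by lia; simpl; lra. }
    rewrite H; lra.
Qed.

Lemma is_pseries_cosh x : is_pseries cosh_coef x (cosh x).
Proof.
assert (H1 := is_exp_Reals x).
assert (H2 := is_exp_Reals (- x)).
apply is_pseries_R in H1; apply is_pseries_R in H2; apply is_pseries_R.
assert (H := is_series_scal_l (/ 2) _ _ (is_series_plus _ _ _ _ H1 H2)).
unfold cosh; replace ((exp x + exp (- x)) / 2)
  with (scal (/ 2) (plus (exp x) (exp (- x))))
  by (unfold scal, plus; simpl; unfold mult; simpl; field).
eapply is_series_ext; [|exact H]; intros n; cbn beta.
unfold cosh_coef, scal, plus; simpl; unfold mult; simpl.
replace (- x) with (-1 * x) by ring; rewrite Rpow_mult_distr.
field; apply INR_fact_neq_0.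
Qed.

Lemma CV_radius_ge a r M :
  (forall n, Rabs (a n * r ^ n) <= M) -> Rbar_le r (CV_radius a).
Proof.
intros H; apply (proj1 (CV_radius_bounded a)); now exists M.
Qed.

Lemma euler_numbers_exist : exists E, is_euler_numbers E.
Proof.
exists (fun k => recip_coef k * INR (fact k)).
assert (Hh : 0 < / 2) by lra.
exists (mkposreal _ Hh); intros x Hx.
assert (Hx2 : Rabs x < / 2).
{ unfold ball in Hx; simpl in Hx; unfold AbsRing_ball, abs, minus, plus, opp in Hx.
  simpl in Hx; rewrite Ropp_0, Rplus_0_r in Hx; exact Hx. }
assert (Hc : Rbar_lt (Rabs x) (CV_radius cosh_coef)).
{ apply Rbar_lt_le_trans with 1; [simpl; lra|].
  apply (CV_radius_ge _ _ 1); intros n; rewrite pow1, Rmult_1_r.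
  apply cosh_coef_bound. }
assert (Hr : Rbar_lt (Rabs x) (CV_radius recip_coef)).
{ apply Rbar_lt_le_trans with (/ 2); [simpl; lra|].
  apply (CV_radius_ge _ _ 1); intros n; rewrite Rabs_mult.
  rewrite (Rabs_pos_eq ((/ 2) ^ n)) by (apply pow_le; lra).
  apply Rle_trans with (2 ^ n * (/ 2) ^ n).
  - apply Rmult_le_compat_r; [apply pow_le; lra|apply recip_coef_bound].
  - rewrite <- Rpow_mult_distr; replace (2 * / 2) with 1 by field.
    rewrite pow1; lra. }
assert (Hs := PSeries_correct _ _ (CV_radius_inside _ _ Hr)).
assert (Hm := is_pseries_mult _ _ _ _ _ (is_pseries_cosh x) Hs Hc Hr).
assert (H1 : is_pseries (PS_mult cosh_coef recip_coef) x 1).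
{ apply is_pseries_R.
  apply is_series_ext with (fun n => match n with O => 1 | S _ => 0 end).
  - intros [|n]; cbn beta; unfold PS_mult;
      match goal with |- ?u = ?v => change (@eq R u v) end.
    + unfold recip_coef, cosh_coef; simpl; field.
    + rewrite decomp_sum by lia; replace (pred (S n)) with n by lia.
      replace (S n - 0)%nat with (S n) by lia; rewrite recip_coef_S.
      change (fun i => cosh_coef (S i) * recip_coef (S n - S i))
        with (fun j => cosh_coef (S j) * recip_coef (n - j)).
      replace (cosh_coef 0) with 1 by (unfold cosh_coef; simpl; field); ring.
  - change (is_lim_seq (sum_n (fun n => match n with O => 1 | S _ => 0 end)) 1).
    apply (is_lim_seq_ext (fun _ => 1)); [|apply is_lim_seq_const].
    intros n; symmetry; induction n as [|n IHn].
    + now rewrite sum_O.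
    + rewrite sum_Sn, IHn; apply Rplus_0_r. }
assert (Hp : cosh x * PSeries recip_coef x = 1).
{ now rewrite <- (is_pseries_unique _ _ _ Hm), (is_pseries_unique _ _ _ H1). }
assert (Hch : cosh x <> 0) by (intros K; rewrite K in Hp; lra).
replace (/ cosh x) with (PSeries recip_coef x)
  by (apply (Rmult_eq_reg_l (cosh x)); [rewrite Hp; field|]; easy).
eapply is_pseries_ext; [|exact Hs].
intros n; cbn beta; unfold Rdiv; rewrite Rmult_assoc, Rinv_r, Rmult_1_r; [easy|].
apply INR_fact_neq_0.
Qed.

Lemma CV_radius_pos a (f : R -> R) :
  locally 0 (fun x : R => is_pseries a x (f x)) -> Rbar_lt 0 (CV_radius a).
Proof.
intros [d Hd].
assert (Hd0 := cond_pos d).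
assert (H : is_pseries a (d / 2) (f (d / 2))).
{ apply Hd; unfold ball; simpl; unfold AbsRing_ball, abs, minus, plus, opp; simpl.
  rewrite Ropp_0, Rplus_0_r, Rabs_pos_eq; lra. }
apply is_pseries_R in H.
apply Rbar_lt_le_trans with (d / 2); [simpl; lra|].
apply Rbar_not_lt_le; intros K.
apply (CV_disk_outside a (d / 2)).
- now rewrite Rabs_pos_eq by lra.
- apply ex_series_lim_0; now exists (f (d / 2)).
Qed.

Lemma euler_numbers_unique E E' :
  is_euler_numbers E -> is_euler_numbers E' -> forall n, E n = E' n.
Proof.
intros H H' n.
assert (K : E n / INR (fact n) = E' n / INR (fact n)).
{ apply (PSeries_ext_recip (fun k => E k / INR (fact k)) (fun k => E' k / INR (fact k))).
  - now apply (CV_radius_pos _ (fun x => / cosh x)).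
  - now apply (CV_radius_pos _ (fun x => / cosh x)).
  - generalize (filter_and _ _ H H'); apply filter_imp; intros x [Hx Hx'].
    now rewrite (is_pseries_unique _ _ _ Hx), (is_pseries_unique _ _ _ Hx'). }
apply (Rmult_eq_reg_r (/ INR (fact n))); [exact K|].
apply Rinv_neq_0_compat, INR_fact_neq_0.
Qed.

(* Main.v *)
Require Import Defs.
From Stdlib Require Import Reals ZArith Lia Lra.
From Coquelicot Require Import Coquelicot.
Open Scope R_scope.

(** Put [s = 2k+1] and let [beta] be the sum of [(-1)^n / (2n+1)^s].  Separating even and
    odd indices, the recursions of the two sequences turn the paperfolding part of the
    series into a multiple of [beta], and the Thue-Morse part into [zeta s].

    It remains to evaluate [beta].  Integrating [z^(2k)/(2k)! * cos((2n+1)z)] over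
    [[0, PI/2]] and summing over [n <= N] gives a combination of partial sums of
    [beta(1)], [beta(3)], ..., [beta(2k+1)]; since the sum of these cosines is
    [sin(2(N+1)z) / (2 sin z)], a Riemann-Lebesgue estimate shows that the combination tends
    to [0].  With [beta(1) = PI/4], the resulting recurrence is, up to scaling, the one that
    [cosh * (1/cosh) = 1] imposes on [E_(2k) / (2k)!]. *)

(** * Real-valued series *)

Lemma is_series_Rplus (f g : nat -> R) (a b : R) :
  is_series f a -> is_series g b -> is_series (fun n => f n + g n) (a + b).
Proof. intros Hf Hg; exact (is_series_plus f g a b Hf Hg). Qed.

Lemma is_series_Rmult_l (c : R) (f : nat -> R) (a : R) :
  is_series f a -> is_series (fun n => c * f n) (c * a).
Proof. intros H; exact (is_series_scal_l c f a H). Qed.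

Lemma is_series_Rext (f g : nat -> R) (a b : R) :
  is_series f a -> (forall n, f n = g n) -> a = b -> is_series g b.
Proof. intros H Hfg <-; exact (is_series_ext f g a Hfg H). Qed.

Lemma is_series_R_unique (f : nat -> R) (a b : R) :
  is_series f a -> is_series f b -> a = b.
Proof.
intros Ha Hb.
now rewrite <- (is_series_unique f a Ha), <- (is_series_unique f b Hb).
Qed.

(** Reads [f] as a power series at 1 and splits it by the parity of the exponent. *)
Lemma is_series_even_odd (f : nat -> R) (a b : R) :
  is_series (fun n => f (2 * n)%nat) a ->
  is_series (fun n => f (2 * n + 1)%nat) b -> is_series f (a + b).
Proof.
intros Ha Hb.
assert (H : is_pseries f 1 (a + 1 * b)).
{ apply is_pseries_odd_even; apply is_pseries_R.
  - eapply is_series_Rext; [exact Ha| |reflexivity].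
    intros n; cbn beta; rewrite <- pow_mult, pow1; ring.
  - eapply is_series_Rext; [exact Hb| |reflexivity].
    intros n; cbn beta; rewrite <- pow_mult, pow1; ring. }
apply is_pseries_R in H.
eapply is_series_Rext; [exact H| |ring].
intros n; cbn beta; rewrite pow1; ring.
Qed.

Lemma is_series_sum_f_R0 (f : nat -> nat -> R) (l : nat -> R) (k : nat) :
  (forall j, is_series (f j) (l j)) ->
  is_series (fun n => sum_f_R0 (fun j => f j n) k) (sum_f_R0 l k).
Proof.
intros H; induction k as [|k IH]; [apply H|].
cbn [sum_f_R0]; now apply is_series_Rplus.
Qed.

Lemma is_lim_seq_inv_INR_S : is_lim_seq (fun n => / INR (S n)) 0.
Proof.
apply (is_lim_seq_incr_1 (fun n => / INR n)).
replace (Finite 0) with (Rbar_inv p_infty) by reflexivity.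
apply is_lim_seq_inv; [apply is_lim_seq_INR|discriminate].
Qed.

(** Telescoping, with partial sums [1 - / INR (S (S n))]; this series serves as the majorant for
    exponents [s >= 2]. *)
Lemma is_series_inv_consecutive :
  is_series (fun n => / (INR (S n) * INR (S (S n)))) 1.
Proof.
change (is_lim_seq (sum_n (fun n => / (INR (S n) * INR (S (S n))))) 1).
apply is_lim_seq_ext with (fun n => 1 - / INR (S (S n))).
- intros n; induction n as [|n IH].
  + rewrite sum_O; simpl; field.
  + rewrite sum_Sn, <- IH; unfold plus; simpl plus; rewrite !S_INR.
    assert (H := pos_INR n); simpl; field; lra.
- replace (Finite 1) with (Finite (1 - 0)) by (f_equal; ring).
  apply is_lim_seq_minus'; [apply is_lim_seq_const|].
  apply (is_lim_seq_incr_1 (fun n => / INR (S n))).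
  apply is_lim_seq_inv_INR_S.
Qed.

(** With [x = n + 1 >= 1] one has [/ x ^ s <= / x ^ 2 <= 2 / (x * (x + 1))], so the telescoping
    series dominates. *)
Lemma ex_series_bounded_over_pow (c : nat -> R) (C : R) (s : nat) :
  (forall n, Rabs (c n) <= C) -> (2 <= s)%nat ->
  ex_series (fun n => c n / INR (S n) ^ s).
Proof.
intros Hc Hs.
apply (@ex_series_le R_AbsRing R_CompleteNormedModule)
  with (b := fun n => 2 * C * / (INR (S n) * INR (S (S n)))).
- intros n; change norm with Rabs.
  assert (Hn : 1 <= INR (S n)) by (rewrite S_INR; generalize (pos_INR n); lra).
  assert (Hp : INR (S n) ^ 2 <= INR (S n) ^ s) by (apply Rle_pow; assumption).
  assert (H2 : 0 < INR (S n) ^ 2) by (apply pow_lt; lra).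
  unfold Rdiv; rewrite Rabs_mult, Rabs_inv, (Rabs_pos_eq (_ ^ s)) by lra.
  replace (2 * C * / (INR (S n) * INR (S (S n))))
    with (C * (2 * / (INR (S n) * INR (S (S n))))) by ring.
  apply Rmult_le_compat; [apply Rabs_pos| |apply Hc|].
  + left; apply Rinv_0_lt_compat; lra.
  + apply Rle_trans with (/ INR (S n) ^ 2); [apply Rinv_le_contravar; lra|].
    rewrite (S_INR (S n)); set (x := INR (S n)) in *.
    apply Rmult_le_reg_r with (x ^ 2 * (x + 1)); [apply Rmult_lt_0_compat; lra|].
    replace (/ x ^ 2 * (x ^ 2 * (x + 1))) with (x + 1) by (field; lra).
    replace (2 * / (x * (x + 1)) * (x ^ 2 * (x + 1))) with (2 * x) by (field; lra).
    lra.
- exists (2 * C * 1).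
  exact (is_series_Rmult_l _ _ _ is_series_inv_consecutive).
Qed.

(** * Dirichlet series of bounded sequences and their odd parts *)

Definition dirichlet (c : nat -> R) (s : nat) : R :=
  Series (fun n => c (S n) / INR (S n) ^ s).

Lemma is_series_dirichlet (c : nat -> R) (C : R) (s : nat) :
  (forall n, Rabs (c n) <= C) -> (2 <= s)%nat ->
  is_series (fun n => c (S n) / INR (S n) ^ s) (dirichlet c s).
Proof.
intros Hc Hs; apply Series_correct.
apply (ex_series_bounded_over_pow (fun n => c (S n)) C); [intros n; apply Hc|exact Hs].
Qed.

Lemma zeta_dirichlet (s : nat) : zeta (INR s) = dirichlet (fun _ => 1) s.
Proof.
apply Series_ext; intros n.
rewrite Rpower_pow by apply lt_0_INR, Nat.lt_0_succ.
unfold Rdiv; ring.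
Qed.

(** The even terms form [/ 2 ^ s] times the series of [c (2 * n)]. A recursion of [c] under doubling
    thus becomes a linear equation for its Dirichlet series. *)
Lemma is_series_odd_part (c : nat -> R) (C : R) (s : nat) :
  (forall n, Rabs (c n) <= C) -> (2 <= s)%nat ->
  is_series (fun n => c (2 * n + 1)%nat / INR (2 * n + 1) ^ s)
    (dirichlet c s - / 2 ^ s * dirichlet (fun n => c (2 * n)%nat) s).
Proof.
intros Hc Hs.
(* Splitting by parity requires the odd part to converge beforehand. Its terms are rewritten over
   [INR (S n) ^ s], with numerators bounded by [C] because [n + 1 <= 2 * n + 1]. *)
assert (Ho : ex_series (fun n => c (2 * n + 1)%nat / INR (2 * n + 1) ^ s)).
{ apply ex_series_ext with
    (fun n => c (2 * n + 1)%nat * (INR (S n) / INR (2 * n + 1)) ^ s / INR (S n) ^ s).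
  - intros n; match goal with |- ?u = ?v => change (@eq R u v) end.
    unfold Rdiv; rewrite Rpow_mult_distr, pow_inv.
    field; split; apply pow_nonzero, not_0_INR; lia.
  - apply ex_series_bounded_over_pow with C; [|exact Hs].
    intros n; rewrite Rabs_mult; rewrite <- (Rmult_1_r C).
    apply Rmult_le_compat; try apply Rabs_pos; [apply Hc|].
    assert (H1 : 0 < INR (2 * n + 1)) by (apply lt_0_INR; lia).
    assert (H2 : INR (S n) <= INR (2 * n + 1)) by (apply le_INR; lia).
    assert (H3 : 0 <= INR (S n)) by apply pos_INR.
    assert (H0 : 0 < / INR (2 * n + 1)) by now apply Rinv_0_lt_compat.
    assert (H4 : 0 <= INR (S n) / INR (2 * n + 1)) by (apply Rmult_le_pos; lra).
    rewrite Rabs_pos_eq by now apply pow_le.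
    rewrite <- (pow1 s); apply pow_incr; split; [exact H4|].
    apply Rmult_le_reg_r with (INR (2 * n + 1)); [exact H1|].
    unfold Rdiv; rewrite Rmult_assoc, Rinv_l; lra. }
change (exists o : R,
  is_series (fun n => c (2 * n + 1)%nat / INR (2 * n + 1) ^ s) o) in Ho.
destruct Ho as [o Ho].
assert (He := is_series_Rmult_l (/ 2 ^ s) _ _
  (is_series_dirichlet (fun n => c (2 * n)%nat) C s (fun n => Hc (2 * n)%nat) Hs)).
assert (H : is_series (fun n => c (S n) / INR (S n) ^ s)
              (o + / 2 ^ s * dirichlet (fun n => c (2 * n)%nat) s)).
(* Position [n] carries the integer [n + 1], so even positions hold the odd integers. *)
{ apply is_series_even_odd.
  - eapply is_series_Rext; [exact Ho| |reflexivity].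
    intros n; cbn beta; now replace (S (2 * n)) with (2 * n + 1)%nat by lia.
  - eapply is_series_Rext; [exact He| |reflexivity].
    intros n; cbn beta; replace (S (2 * n + 1)) with (2 * S n)%nat by lia.
    rewrite mult_INR, Rpow_mult_distr; simpl (INR 2).
    replace (1 + 1) with 2 by ring.
    field; split; apply pow_nonzero; [apply not_0_INR; lia|lra]. }
rewrite (is_series_R_unique _ _ _ (is_series_dirichlet c C s Hc Hs) H).
eapply is_series_Rext; [exact Ho|reflexivity|ring].
Qed.

Lemma dirichlet_ext (c d : nat -> R) (s : nat) :
  (forall n, (1 <= n)%nat -> c n = d n) -> dirichlet c s = dirichlet d s.
Proof. intros H; apply Series_ext; intros n; rewrite H; [easy|lia]. Qed.

(** * The Thue-Morse sequence *)

Lemma thue_morse_cases (t : nat -> Z) :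
  is_thue_morse t -> forall n, t n = 0%Z \/ t n = 1%Z.
Proof.
intros [H0 [He Ho]] n.
induction n as [n IH] using (well_founded_induction Wf_nat.lt_wf).
destruct (Nat.Even_or_Odd n) as [[m ->]|[m ->]].
- destruct m as [|m]; [now left|].
  rewrite He; apply IH; lia.
- rewrite Ho; destruct (IH m); lia.
Qed.

Lemma Rabs_thue_morse_le_1 (t : nat -> Z) :
  is_thue_morse t -> forall n, Rabs (IZR (t n)) <= 1.
Proof.
intros Ht n; destruct (thue_morse_cases t Ht n) as [-> | ->].
- rewrite Rabs_R0; lra.
- rewrite Rabs_R1; lra.
Qed.

(** Write [x], [y], [z] for the three series in order of appearance. Since [t (2n) + t (2n+1) = 1],
    the odd parts of [x] and [y] add up to that of [z]. Since [t (2n-1) = 1 - t (n-1)] and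
    [t (2n) = t n], the even parts of [x] and [y] are [(z - x) / 2^s] and [y / 2^s]. Hence [x + y -
    (z - x) / 2^s - y / 2^s = z - z / 2^s]. *)
Lemma thue_morse_dirichlet (t : nat -> Z) (s : nat) :
  is_thue_morse t -> (2 <= s)%nat ->
  (2 ^ s + 1) * dirichlet (fun n => IZR (t (n - 1)%nat)) s
  + (2 ^ s - 1) * dirichlet (fun n => IZR (t n)) s
  = 2 ^ s * dirichlet (fun _ => 1) s.
Proof.
intros Ht Hs.
assert (Hb := Rabs_thue_morse_le_1 t Ht).
destruct Ht as [_ [He Ho]].
set (A := fun n => IZR (t (n - 1)%nat)); set (B := fun n => IZR (t n)).
assert (HA := is_series_odd_part A 1 s (fun n => Hb _) Hs).
assert (HB := is_series_odd_part B 1 s Hb Hs).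
assert (H1 := is_series_odd_part (fun _ => 1) 1 s (fun _ => Req_le _ _ Rabs_R1) Hs).
assert (EA : dirichlet (fun n => A (2 * n)%nat) s
             = dirichlet (fun _ => 1) s - dirichlet A s).
{ apply is_series_unique; eapply is_series_Rext.
  - apply is_series_Rplus.
    + apply (is_series_dirichlet (fun _ => 1) 1 s (fun _ => Req_le _ _ Rabs_R1) Hs).
    + apply (is_series_Rmult_l (-1)), (is_series_dirichlet A 1 s (fun n => Hb _) Hs).
  - intros n; unfold A.
    replace (2 * S n - 1)%nat with (2 * n + 1)%nat by lia.
    rewrite Ho, minus_IZR; replace (S n - 1)%nat with n by lia.
    unfold Rdiv; ring.
  - ring. }
assert (EB : dirichlet (fun n => B (2 * n)%nat) s = dirichlet B s).
{ apply dirichlet_ext; intros n _; unfold B; now rewrite He. }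
assert (HAB : is_series (fun n => 1 / INR (2 * n + 1) ^ s)
  ((dirichlet A s - / 2 ^ s * dirichlet (fun n => A (2 * n)%nat) s)
   + (dirichlet B s - / 2 ^ s * dirichlet (fun n => B (2 * n)%nat) s))).
{ eapply is_series_Rext; [exact (is_series_Rplus _ _ _ _ HA HB)| |reflexivity].
  intros n; unfold A, B; cbn beta.
  replace (2 * n + 1 - 1)%nat with (2 * n)%nat by lia.
  rewrite He, Ho, minus_IZR; unfold Rdiv; ring. }
assert (Eq := is_series_R_unique _ _ _ H1 HAB).
cbv beta in Eq; rewrite EA, EB in Eq.
assert (Hp : 2 ^ s <> 0) by (apply pow_nonzero; lra).
apply (f_equal (Rmult (2 ^ s))) in Eq.
field_simplify in Eq; [|exact Hp|exact Hp].
lra.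
Qed.

(** * The paperfolding sequence *)

Lemma paperfolding_cases (b : nat -> Z) :
  is_paperfolding b -> forall n, (1 <= n)%nat -> b n = 0%Z \/ b n = 1%Z.
Proof.
intros [He [H1 H3]] n.
induction n as [n IH] using (well_founded_induction Wf_nat.lt_wf); intros Hn.
destruct (Nat.Even_or_Odd n) as [[m ->]|[m ->]].
- rewrite He by lia; apply IH; lia.
- destruct (Nat.Even_or_Odd m) as [[l ->]|[l ->]].
  + left; rewrite <- (H1 l); f_equal; lia.
  + right; rewrite <- (H3 l); f_equal; lia.
Qed.

Lemma paperfolding_odd_sign (b : nat -> Z) (n : nat) :
  is_paperfolding b -> 2 * IZR (b (2 * n + 1)%nat) - 1 = - (-1) ^ n.
Proof.
intros [_ [H1 H3]]; destruct (Nat.Even_or_Odd n) as [[m ->]|[m ->]].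
- replace (2 * (2 * m) + 1)%nat with (4 * m + 1)%nat by lia.
  rewrite H1, pow_1_even; ring.
- replace (2 * (2 * m + 1) + 1)%nat with (4 * m + 3)%nat by lia.
  rewrite H3; replace (2 * m + 1)%nat with (S (2 * m)) by lia.
  rewrite pow_1_odd; ring.
Qed.

(** The signs [2 * b n - 1] are invariant under doubling [n], and at [2 * n + 1] they equal
    [- (-1) ^ n]. Their series [S] therefore satisfies [(1 - / 2 ^ s) * S = - beta]. *)
Lemma is_series_paperfolding (b : nat -> Z) (s : nat) (beta : R) :
  is_paperfolding b -> (2 <= s)%nat ->
  is_series (fun n => (-1) ^ n / INR (2 * n + 1) ^ s) beta ->
  is_series (fun n => (2 * IZR (b (S n)) - 1) / INR (S n) ^ s)
    (- 2 ^ s / (2 ^ s - 1) * beta).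
Proof.
intros Hb Hs Hbeta.
(* The value b 0 is unconstrained, so it is overridden to make c bounded. *)
set (c := fun n => match n with O => 0 | S _ => 2 * IZR (b n) - 1 end).
assert (Hc : forall n, Rabs (c n) <= 1).
{ intros [|n]; unfold c; [rewrite Rabs_R0; lra|].
  destruct (paperfolding_cases b Hb (S n)) as [-> | ->]; [lia| |];
    apply Rabs_le; lra. }
assert (H := is_series_odd_part c 1 s Hc Hs).
assert (H' : is_series (fun n => c (2 * n + 1)%nat / INR (2 * n + 1) ^ s) (-1 * beta)).
{ eapply is_series_Rext; [exact (is_series_Rmult_l (-1) _ _ Hbeta)| |reflexivity].
  intros n; cbn beta.
  replace (c (2 * n + 1)%nat) with (- (-1) ^ n); [unfold Rdiv; ring|].
  rewrite <- (paperfolding_odd_sign b n Hb).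
  now replace (2 * n + 1)%nat with (S (2 * n)) by lia. }
assert (Eq := is_series_R_unique _ _ _ H H').
rewrite (dirichlet_ext (fun n => c (2 * n)%nat) c) in Eq.
2:{ intros [|n] Hn; [lia|]; destruct Hb as [He _].
  replace (2 * S n)%nat with (S (2 * n + 1)) by lia; unfold c.
  replace (S (2 * n + 1)) with (2 * S n)%nat by lia; now rewrite He. }
assert (H1 : 2 ^ 2 <= 2 ^ s) by (apply Rle_pow; [lra|exact Hs]).
eapply is_series_Rext; [exact (is_series_dirichlet c 1 s Hc Hs)|reflexivity|].
apply Rmult_eq_reg_l with ((2 ^ s - 1) / 2 ^ s).
- transitivity (-1 * beta); [rewrite <- Eq|]; field; lra.
- apply Rmult_integral_contrapositive_currified; [lra|].
  apply Rinv_neq_0_compat; lra.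
Qed.

(** * The Dirichlet beta function at odd positive integers *)

Lemma INR_odd_pos (n : nat) : 0 < INR (2 * n + 1).
Proof. apply lt_0_INR; lia. Qed.

Definition beta (j : nat) : R :=
  Series (fun n => (-1) ^ n / INR (2 * n + 1) ^ (2 * j + 1)).

Lemma inv_odd_pow_decreasing (j : nat) :
  Un_decreasing (fun n => / INR (2 * n + 1) ^ (2 * j + 1)).
Proof.
intros n; assert (H := INR_odd_pos n).
apply Rinv_le_contravar; [now apply pow_lt|].
apply pow_incr; split; [lra|apply le_INR; lia].
Qed.

Lemma inv_odd_pow_cv_0 (j : nat) :
  Un_cv (fun n => / INR (2 * n + 1) ^ (2 * j + 1)) 0.
Proof.
apply is_lim_seq_Reals.
apply is_lim_seq_le_le with (fun _ => 0) (fun n => / INR (S n)).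
- intros n; assert (H := INR_odd_pos n); split.
  + left; apply Rinv_0_lt_compat; now apply pow_lt.
  + apply Rinv_le_contravar; [apply lt_0_INR; lia|].
    apply Rle_trans with (INR (2 * n + 1) ^ 1).
    * rewrite pow_1; apply le_INR; lia.
    * apply Rle_pow; [apply (le_INR 1); lia|lia].
- apply is_lim_seq_const.
- apply is_lim_seq_inv_INR_S.
Qed.

(** The alternating series test also covers [j = 0], where convergence is only conditional. *)
Lemma is_series_beta (j : nat) :
  is_series (fun n => (-1) ^ n / INR (2 * n + 1) ^ (2 * j + 1)) (beta j).
Proof.
apply Series_correct.
destruct (alternated_series _ (inv_odd_pow_decreasing j) (inv_odd_pow_cv_0 j)) as [l Hl].
exists l; apply is_series_Reals; exact Hl.
Qed.

(** The first two terms give a nonnegative lower bound. This sign later accounts for the absolute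
    value of the Euler number. *)
Lemma beta_nonneg (j : nat) : 0 <= beta j.
Proof.
assert (H := is_series_beta j); apply is_series_Reals in H.
destruct (alternated_series_ineq _ (beta j) 0
  (inv_odd_pow_decreasing j) (inv_odd_pow_cv_0 j) H) as [H1 _].
assert (H2 := inv_odd_pow_decreasing j 0%nat).
set (U := fun n => / INR (2 * n + 1) ^ (2 * j + 1)) in *.
replace (sum_f_R0 (tg_alt U) (S (2 * 0))) with (U 0%nat - U 1%nat) in H1
  by (unfold tg_alt; cbn -[U]; ring).
lra.
Qed.

(** Leibniz's series: [Alt_PI] is four times its sum, and [Alt_PI_eq] identifies [Alt_PI] with
    [PI]. *)
Lemma beta_0 : beta 0 = PI / 4.
Proof.
assert (H := is_series_beta 0); apply is_series_Reals in H.
rewrite <- Alt_PI_eq; unfold Alt_PI; destruct exist_PI as [l Hl].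
replace (4 * l / 4) with l by field.
apply (UL_sequence _ _ _ H).
apply Un_cv_ext with (2 := Hl); intros n; apply sum_eq; intros i _.
unfold tg_alt, PI_tg; replace (2 * 0 + 1)%nat with 1%nat by lia.
now rewrite pow_1.
Qed.

(** * Integrals of even powers against cosines *)

(* An antiderivative of z ^ (2 k) / (2 k)! * cos (m z), from integrating by parts twice. *)
Fixpoint cos_moment (m : R) (k : nat) (z : R) : R :=
  match k with
  | O => sin (m * z) / m
  | S j => z ^ S (S (2 * j)) / INR (fact (S (S (2 * j)))) * (sin (m * z) / m)
           + z ^ S (2 * j) / INR (fact (S (2 * j))) * (cos (m * z) / m ^ 2)
           - cos_moment m j z / m ^ 2
  end.

Lemma is_derive_Rext (f g : R -> R) (z a b : R) :
  is_derive f z a -> (forall x, f x = g x) -> a = b -> is_derive g z b.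
Proof. intros H Hfg <-; exact (is_derive_ext f g z a Hfg H). Qed.

Lemma is_derive_Rplus (f g : R -> R) (z a b : R) :
  is_derive f z a -> is_derive g z b -> is_derive (fun x => f x + g x) z (a + b).
Proof. intros Hf Hg; exact (is_derive_plus f g z a b Hf Hg). Qed.

(** By the product rule the sine terms of the first two summands cancel, and the remaining cosine
    term of the second cancels the derivative of the third, known by induction. *)
Lemma is_derive_cos_moment (m : R) (k : nat) (z : R) :
  m <> 0 ->
  is_derive (cos_moment m k) z (z ^ (2 * k) / INR (fact (2 * k)) * cos (m * z)).
Proof.
intros Hm; induction k as [|k IH]; cbn [cos_moment].
- apply (is_derive_Rext (fun z => sin (m * z) / m) _ _ (cos (m * z))); [|reflexivity|].
  + auto_derive; [trivial|]; field; exact Hm.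
  + simpl; field.
- replace (2 * S k)%nat with (S (S (2 * k))) by lia.
  set (n := (2 * k)%nat) in *.
  assert (F0 := INR_fact_neq_0 n).
  assert (F1 : INR (fact (S n)) = INR (S n) * INR (fact n)) by now rewrite <- mult_INR.
  assert (F2 : INR (fact (S (S n))) = INR (S (S n)) * INR (fact (S n)))
    by now rewrite <- mult_INR.
  assert (N1 : INR (S n) <> 0) by now apply not_0_INR.
  assert (N2 : INR (S (S n)) <> 0) by now apply not_0_INR.
  (* A generic [c] stands for the factorial, which [auto_derive] and [field] then never see. *)
  assert (P1 : forall c, c <> 0 ->
    is_derive (fun z => z ^ S (S n) / c * (sin (m * z) / m)) z
      (INR (S (S n)) * z ^ S n / c * (sin (m * z) / m) + z ^ S (S n) / c * cos (m * z))).
  { intros c Hc; auto_derive; [trivial|].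
    change (match n with O => 1 | S _ => INR n + 1 end) with (INR (S n)).
    rewrite !(S_INR (S n)), !(S_INR n); cbn [Init.Nat.pred]; simpl pow.
    field; now split. }
  assert (P2 : forall c, c <> 0 ->
    is_derive (fun z => z ^ S n / c * (cos (m * z) / m ^ 2)) z
      (INR (S n) * z ^ n / c * (cos (m * z) / m ^ 2) - z ^ S n / c * (sin (m * z) / m))).
  { intros c Hc; auto_derive; [trivial|].
    change (match n with O => 1 | S _ => INR n + 1 end) with (INR (S n)).
    rewrite !(S_INR n); cbn [Init.Nat.pred]; simpl pow.
    field; now split. }
  specialize (P1 _ (INR_fact_neq_0 (S (S n)))).
  specialize (P2 _ (INR_fact_neq_0 (S n))).
  eapply is_derive_Rext.
  + apply is_derive_Rplus; [exact (is_derive_Rplus _ _ _ _ _ P1 P2)|].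
    exact (is_derive_scal _ _ (- / m ^ 2) _ IH).
  + intros x; cbn beta; unfold Rdiv; ring.
  + rewrite F2, F1; field; repeat split; trivial.
Qed.

Lemma cos_moment_0 (m : R) (k : nat) : cos_moment m k 0 = 0.
Proof.
induction k as [|k IH]; cbn [cos_moment].
- rewrite Rmult_0_r, sin_0; unfold Rdiv; ring.
- rewrite IH, !pow_ne_zero by lia; unfold Rdiv; ring.
Qed.

Lemma cos_sin_odd_PI2 (n : nat) :
  cos (INR (2 * n + 1) * (PI / 2)) = 0 /\ sin (INR (2 * n + 1) * (PI / 2)) = (-1) ^ n.
Proof.
induction n as [|n [IHc IHs]].
- simpl; rewrite Rmult_1_l, cos_PI2, sin_PI2; split; reflexivity.
- replace (INR (2 * S n + 1) * (PI / 2)) with (INR (2 * n + 1) * (PI / 2) + PI).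
  + rewrite neg_cos, neg_sin, IHc, IHs; simpl; split; ring.
  + replace (2 * S n + 1)%nat with (2 * n + 1 + 2)%nat by lia.
    rewrite (plus_INR (2 * n + 1) 2); simpl (INR 2); field.
Qed.

(** At [PI / 2] the cosine terms vanish and the sine is [(-1) ^ n]; each unfolding of the recursion
    contributes a factor [- / m ^ 2]. *)
Lemma cos_moment_PI2 (n k : nat) :
  cos_moment (INR (2 * n + 1)) k (PI / 2)
  = sum_f_R0 (fun j => (-1) ^ j * ((PI / 2) ^ (2 * (k - j)) / INR (fact (2 * (k - j))))
                       * ((-1) ^ n / INR (2 * n + 1) ^ (2 * j + 1))) k.
Proof.
destruct (cos_sin_odd_PI2 n) as [Hc Hs].
assert (Hm : INR (2 * n + 1) <> 0) by (apply not_0_INR; lia).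
set (m := INR (2 * n + 1)) in *.
induction k as [|k IH]; cbn [cos_moment].
- rewrite Hs; simpl; field; exact Hm.
(* The term [j = 0] is the new sine term; the others come from the induction hypothesis, shifted by
   one. *)
- rewrite decomp_sum by lia; cbn [Init.Nat.pred].
  rewrite Hs, Hc, IH.
  rewrite (sum_eq (fun i => (-1) ^ S i * _ * _)
    (fun j => (-1) ^ j * ((PI / 2) ^ (2 * (k - j)) / INR (fact (2 * (k - j))))
              * ((-1) ^ n / m ^ (2 * j + 1)) * (- / m ^ 2))).
  + rewrite <- scal_sum.
    replace (S k - 0)%nat with (S k) by lia.
    replace (2 * S k)%nat with (S (S (2 * k))) by lia.
    replace (2 * 0 + 1)%nat with 1%nat by lia.
    rewrite pow_1; unfold Rdiv; ring.
  + intros i _; replace (S k - S i)%nat with (k - i)%nat by lia.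
    replace (2 * S i + 1)%nat with (2 * i + 1 + 2)%nat by lia.
    rewrite (pow_add m); simpl ((-1) ^ S i); field.
    repeat split; trivial; [now apply pow_nonzero|apply INR_fact_neq_0].
Qed.

(** * Decay of the summed integrals *)

Lemma odd_cos_sum (N : nat) (z : R) :
  2 * sin z * sum_f_R0 (fun n => cos (INR (2 * n + 1) * z)) N = sin (2 * INR (S N) * z).
Proof.
induction N as [|N IH].
- cbn [sum_f_R0]; replace (2 * 0 + 1)%nat with 1%nat by lia.
  rewrite INR_1, Rmult_1_l, Rmult_1_r, sin_2a; ring.
- cbn [sum_f_R0]; rewrite Rmult_plus_distr_l, IH.
  replace (INR (2 * S N + 1)) with (2 * INR (S N) + 1)
    by (rewrite plus_INR, mult_INR; simpl (INR 2); simpl (INR 1); ring).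
  rewrite (S_INR (S N)).
  (* Both sines are centred at the frequency of the new cosine, so that the addition formulas make
     the sum telescope. *)
  replace (2 * (INR (S N) + 1) * z) with ((2 * INR (S N) + 1) * z + z) by ring.
  replace (2 * INR (S N) * z) with ((2 * INR (S N) + 1) * z - z) by ring.
  rewrite sin_minus, sin_plus; ring.
Qed.

(** From [sin z >= z - z ^ 3 / 6] and [z ^ 2 <= 4]. The range contains [[0, PI / 2]], as
    [PI <= 4]. *)
Lemma sin_ge_third (z : R) : 0 <= z <= 2 -> z / 3 <= sin z.
Proof.
intros Hz; destruct (pre_sin_bound z 0) as [H _]; [lra|lra|].
unfold sin_approx, sin_term in H; cbn in H.
nra.
Qed.

Definition cos_moment_sum (k N : nat) (z : R) : R :=
  sum_f_R0 (fun n => cos_moment (INR (2 * n + 1)) k z) N.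

Lemma is_derive_cos_moment_sum (k N : nat) (z : R) :
  is_derive (cos_moment_sum k N) z
    (z ^ (2 * k) / INR (fact (2 * k)) * sum_f_R0 (fun n => cos (INR (2 * n + 1) * z)) N).
Proof.
assert (H : forall n, INR (2 * n + 1) <> 0) by (intros n; apply not_0_INR; lia).
induction N as [|N IH].
- apply (is_derive_cos_moment (INR (2 * 0 + 1))), H.
- eapply is_derive_Rext.
  + exact (is_derive_Rplus _ _ _ _ _ IH (is_derive_cos_moment _ k z (H (S N)))).
  + reflexivity.
  + cbn [sum_f_R0]; ring.
Qed.

Lemma cos_moment_sum_0 (k N : nat) : cos_moment_sum k N 0 = 0.
Proof.
unfold cos_moment_sum; rewrite (sum_eq _ (fun _ => 0)).
- rewrite sum_cte; ring.
- intros n _; apply cos_moment_0.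
Qed.

Lemma Rabs_diff_le_derive (f f' : R -> R) (a b C : R) :
  a < b -> (forall c, a <= c <= b -> is_derive f c (f' c)) ->
  (forall c, a < c < b -> Rabs (f' c) <= C) ->
  Rabs (f b - f a) <= C * (b - a).
Proof.
intros Hab Hd HC.
destruct (MVT_cor2 f f' a b Hab) as [c [-> Hc]].
- intros c Hc; apply is_derive_Reals, Hd, Hc.
- rewrite Rabs_mult, (Rabs_pos_eq (b - a)) by lra.
  apply Rmult_le_compat_r; [lra|now apply HC].
Qed.

Lemma Rabs_sin_le_1 (x : R) : Rabs (sin x) <= 1.
Proof. apply Rabs_le, SIN_bound. Qed.

Lemma Rabs_cos_le_1 (x : R) : Rabs (cos x) <= 1.
Proof. apply Rabs_le, COS_bound. Qed.

(** The common shape of the estimates below: an inverse factorial, a sine or cosine, a scale [r],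
    and a quotient by a sine. *)
Lemma Rabs_mult4_le (a b r g G : R) :
  0 < a <= 1 -> Rabs b <= 1 -> 0 <= r -> Rabs g <= G ->
  Rabs (a * b * r * g) <= r * G.
Proof.
intros Ha Hb Hr Hg.
rewrite !Rabs_mult, (Rabs_pos_eq a), (Rabs_pos_eq r) by lra.
assert (Hb0 := Rabs_pos b); assert (Hg0 := Rabs_pos g).
replace (r * G) with (1 * r * G) by ring.
apply Rmult_le_compat; [repeat apply Rmult_le_pos; lra|lra| |exact Hg].
apply Rmult_le_compat_r; [exact Hr|nra].
Qed.

(** Dividing by [sin z >= z / 3] costs one power of [z] and a factor 3; the remaining [z ^ S q] is
    at most [2 * 2 ^ q]. *)
Lemma pow_over_sin_bound (q : nat) (z : R) :
  0 < z <= 2 -> Rabs (z ^ S (S q) / sin z) <= 6 * 2 ^ q.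
Proof.
intros Hz; assert (Hs := sin_ge_third z ltac:(lra)).
assert (Hq : 0 <= z ^ q <= 2 ^ q) by (split; [apply pow_le|apply pow_incr]; lra).
rewrite Rabs_pos_eq by (apply Rmult_le_pos; [apply pow_le|left; apply Rinv_0_lt_compat]; lra).
apply Rmult_le_reg_r with (sin z); [lra|].
unfold Rdiv; rewrite Rmult_assoc, Rinv_l, Rmult_1_r by lra; simpl pow.
apply Rle_trans with (6 * 2 ^ q * (z / 3)); [|nra].
assert (z * (z * z ^ q) <= 2 * (z * 2 ^ q)); [|lra].
apply Rmult_le_compat; try lra; [apply Rmult_le_pos; lra|].
apply Rmult_le_compat_l; lra.
Qed.

(** The quotient is the derivative of [z ^ S (S q) / sin z]. By [sin z < z] its numerator is at most
    [(q + 3) * z ^ S (S q)] in absolute value, and [sin z ^ 2 >= z ^ 2 / 9] absorbs two powers of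
    [z]. *)
Lemma pow_over_sin_derive_bound (q : nat) (z : R) :
  0 < z <= 2 ->
  Rabs ((INR (S (S q)) * z ^ S q * sin z - z ^ S (S q) * cos z) / sin z ^ 2)
  <= 9 * (INR (S (S q)) + 1) * 2 ^ q.
Proof.
intros Hz; assert (Hs := sin_ge_third z ltac:(lra)).
assert (Hs' := sin_lt_x z ltac:(lra)).
assert (Hq : 0 <= z ^ q <= 2 ^ q) by (split; [apply pow_le|apply pow_incr]; lra).
assert (Hp : 0 <= INR (S (S q))) by apply pos_INR.
assert (H2 : 0 < sin z ^ 2) by (apply pow_lt; lra).
unfold Rdiv; rewrite Rabs_mult, Rabs_inv, (Rabs_pos_eq (sin z ^ 2)) by lra.
apply Rmult_le_reg_r with (sin z ^ 2); [lra|].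
rewrite Rmult_assoc, Rinv_l, Rmult_1_r by lra.
assert (Hn : 0 <= z ^ S q) by (apply pow_le; lra).
assert (Hn' : 0 <= z ^ S (S q)) by (apply pow_le; lra).
apply Rle_trans with ((INR (S (S q)) + 1) * z ^ S (S q)).
- eapply Rle_trans; [apply Rabs_triang|].
  rewrite Rabs_Ropp, !Rabs_mult, (Rabs_pos_eq (INR _)), (Rabs_pos_eq (z ^ S q)),
    (Rabs_pos_eq (sin z)), (Rabs_pos_eq (z ^ S (S q))) by lra.
  rewrite Rmult_plus_distr_r; apply Rplus_le_compat.
  + rewrite Rmult_assoc; apply Rmult_le_compat_l; [exact Hp|].
    change (z ^ S (S q)) with (z * z ^ S q); nra.
  + rewrite Rmult_1_l; assert (Hc := Rabs_cos_le_1 z); nra.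
- replace (9 * (INR (S (S q)) + 1) * 2 ^ q * sin z ^ 2)
    with ((INR (S (S q)) + 1) * (2 ^ q * (9 * sin z ^ 2))) by ring.
  apply Rmult_le_compat_l; [lra|].
  replace (z ^ S (S q)) with (z ^ q * z ^ 2) by (simpl; ring).
  apply Rmult_le_compat; [lra|apply pow_le; lra|lra|simpl; nra].
Qed.

(* Near 0 the derivative is bounded; away from 0 the sum of cosines is
   sin (2 (N+1) z) / (2 sin z), and adding cos (2 (N+1) z) z ^ (2 k) / (4 (N+1) sin z)
   cancels its oscillation up to O(1/N). *)
Lemma cos_moment_sum_bound (k : nat) :
  (1 <= k)%nat ->
  exists C, forall N, Rabs (cos_moment_sum k N (PI / 2)) <= C / INR (S N).
Proof.
(* The subtraction is exact because [k >= 1]; the two powers split off compensate the zero of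
   [sin z ^ 2] at 0. *)
intros Hk; set (q := (2 * k - 2)%nat).
assert (Hq : (2 * k)%nat = S (S q)) by (unfold q; lia).
set (p := INR (S (S q))).
(* The piece near 0 contributes 3, the two boundary values of [h] contribute 3/2 each, and the rest
   of the interval at most [9 / 2 * (p + 1)], all times [2 ^ q / M]. *)
exists ((6 + 9 * (p + 1)) * 2 ^ q); intros N.
set (F := INR (fact (S (S q)))).
set (D := fun z => sum_f_R0 (fun n => cos (INR (2 * n + 1) * z)) N).
assert (Hder : forall z, is_derive (cos_moment_sum k N) z (z ^ S (S q) / F * D z)).
{ intros z; unfold F; rewrite <- Hq; apply is_derive_cos_moment_sum. }
set (M := INR (S N)).
assert (HM : 1 <= M) by (apply (le_INR 1); lia).
assert (HF : 1 <= F) by (apply (le_INR 1), lt_O_fact).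
assert (HiF : 0 < / F <= 1).
{ split; [apply Rinv_0_lt_compat; lra|].
  rewrite <- Rinv_1; apply Rinv_le_contravar; lra. }
assert (HiM : 0 < / M <= 1).
{ split; [apply Rinv_0_lt_compat; lra|].
  rewrite <- Rinv_1; apply Rinv_le_contravar; lra. }
assert (HQ : 0 < 2 ^ q) by (apply pow_lt; lra).
assert (Hp : 0 <= p) by apply pos_INR.
(* These give [1 < PI / 2 <= 2], so the splitting point [/ M] lies before [PI / 2] and the bounds on
   [(0, 2]] apply. *)
assert (HP1 := PI2_1); assert (HP2 := PI_4).
assert (HD : forall z, 0 < z <= 2 -> D z = sin (2 * M * z) / (2 * sin z)).
{ intros z Hz; assert (Hs := sin_ge_third z ltac:(lra)).
  unfold M; rewrite <- odd_cos_sum; unfold D; field; lra. }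
set (h := fun z => / F * cos (2 * M * z) / (4 * M) * (z ^ S (S q) / sin z)).
assert (Hh : forall z, 0 < z <= 2 -> Rabs (h z) <= 3 / 2 * 2 ^ q * / M).
{ intros z Hz.
  replace (3 / 2 * 2 ^ q * / M) with (/ (4 * M) * (6 * 2 ^ q)) by (field; lra).
  apply Rabs_mult4_le; [exact HiF|apply Rabs_cos_le_1| |now apply pow_over_sin_bound].
  left; apply Rinv_0_lt_compat; lra. }
assert (H0 : Rabs (cos_moment_sum k N (/ M) - cos_moment_sum k N 0) <= 3 * 2 ^ q * (/ M - 0)).
{ apply Rabs_diff_le_derive with (fun z => z ^ S (S q) / F * D z); [lra|intros; apply Hder|].
  intros z Hz; rewrite HD by lra.
  replace (z ^ S (S q) / F * (sin (2 * M * z) / (2 * sin z)))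
    with (/ F * sin (2 * M * z) * / 2 * (z ^ S (S q) / sin z)).
  2:{ assert (Hs := sin_ge_third z ltac:(lra)); field; lra. }
  replace (3 * 2 ^ q) with (/ 2 * (6 * 2 ^ q)) by field.
  apply Rabs_mult4_le; [exact HiF|apply Rabs_sin_le_1|lra|].
  apply pow_over_sin_bound; lra. }
(* Differentiating the cosine in [h] cancels the integrand exactly; what is left keeps the factor
   [/ (4 * M)]. *)
assert (H1 : Rabs (cos_moment_sum k N (PI / 2) + h (PI / 2)
                   - (cos_moment_sum k N (/ M) + h (/ M)))
             <= 9 / 4 * (p + 1) * 2 ^ q * / M * (PI / 2 - / M)).
{ apply (Rabs_diff_le_derive (fun z => cos_moment_sum k N z + h z)
    (fun z => / F * cos (2 * M * z) / (4 * M) *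
      ((p * z ^ S q * sin z - z ^ S (S q) * cos z) / sin z ^ 2))); [lra| |].
  - intros z Hz; assert (Hs := sin_ge_third z ltac:(lra)).
    assert (Hd : is_derive h z
       (- / F * sin (2 * M * z) / 2 * (z ^ S (S q) / sin z)
        + / F * cos (2 * M * z) / (4 * M) *
      ((p * z ^ S q * sin z - z ^ S (S q) * cos z) / sin z ^ 2))).
    { unfold h; auto_derive; [lra|].
      change (match q with O => 1 | S _ => INR q + 1 end) with (INR (S q)).
      unfold p; rewrite !(S_INR (S q)); cbn [Init.Nat.pred]; simpl pow; field; lra. }
    eapply is_derive_Rext; [exact (is_derive_Rplus _ _ _ _ _ (Hder z) Hd)|reflexivity|].
    rewrite HD by lra; field; lra.
  - intros z Hz.
    replace (9 / 4 * (p + 1) * 2 ^ q * / M)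
      with (/ (4 * M) * (9 * (p + 1) * 2 ^ q)) by (field; lra).
    apply Rabs_mult4_le; [exact HiF|apply Rabs_cos_le_1| |].
    + left; apply Rinv_0_lt_compat; lra.
    + apply pow_over_sin_derive_bound; lra. }
rewrite cos_moment_sum_0 in H0.
assert (H2 := Hh (PI / 2) ltac:(lra)); assert (H3 := Hh (/ M) ltac:(lra)).
assert (H4 : 9 / 4 * (p + 1) * 2 ^ q * / M * (PI / 2 - / M)
             <= 9 / 4 * (p + 1) * 2 ^ q * / M * 2).
{ apply Rmult_le_compat_l; [|lra].
  repeat apply Rmult_le_pos; lra. }
assert (H5 : 0 <= (p + 1) * 2 ^ q * / M) by (repeat apply Rmult_le_pos; lra).
unfold Rdiv at 2.
apply Rabs_le_between in H0, H1, H2, H3; apply Rabs_le; lra.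
Qed.

(** The series over [n] of the values at [PI / 2] has this combination as its sum, while its partial
    sums are [cos_moment_sum k N (PI / 2)], of size at most [C / (N + 1)]. *)
Lemma beta_recurrence (k : nat) :
  (1 <= k)%nat ->
  sum_f_R0 (fun j => (-1) ^ j * ((PI / 2) ^ (2 * (k - j)) / INR (fact (2 * (k - j))))
                     * beta j) k = 0.
Proof.
intros Hk; destruct (cos_moment_sum_bound k Hk) as [C HC].
assert (H : is_series (fun n => cos_moment (INR (2 * n + 1)) k (PI / 2))
  (sum_f_R0 (fun j => (-1) ^ j * ((PI / 2) ^ (2 * (k - j)) / INR (fact (2 * (k - j))))
                     * beta j) k)).
{ eapply is_series_Rext; [|intros n; symmetry; apply cos_moment_PI2|reflexivity].
  apply (is_series_sum_f_R0 (fun j n =>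
    (-1) ^ j * ((PI / 2) ^ (2 * (k - j)) / INR (fact (2 * (k - j))))
    * ((-1) ^ n / INR (2 * n + 1) ^ (2 * j + 1)))).
  intros j; apply is_series_Rmult_l, is_series_beta. }
apply is_series_Reals in H.
refine (UL_sequence _ _ _ H _); apply is_lim_seq_Reals.
apply is_lim_seq_abs_0, is_lim_seq_le_le with (fun _ => 0) (fun N => C * / INR (S N)).
- intros N; split; [apply Rabs_pos|apply HC].
- apply is_lim_seq_const.
- replace (Finite 0) with (Rbar_mult C 0) by (simpl; f_equal; ring).
  apply is_lim_seq_scal_l, is_lim_seq_inv_INR_S.
Qed.

(** * Comparison with the Euler numbers *)

(** As [d 0 = 1], each relation expresses its top coefficient through the earlier ones. Applied to
    the rescaled [beta] values and to the even coefficients of [1 / cosh]. *)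
Lemma reciprocal_unique (d u v : nat -> R) :
  d 0%nat = 1 -> u 0%nat = v 0%nat ->
  (forall k, (1 <= k)%nat -> sum_f_R0 (fun j => u j * d (k - j)%nat) k = 0) ->
  (forall k, (1 <= k)%nat -> sum_f_R0 (fun j => v j * d (k - j)%nat) k = 0) ->
  forall k, u k = v k.
Proof.
intros Hd H0 Hu Hv k.
induction k as [k IH] using (well_founded_induction Wf_nat.lt_wf).
destruct k as [|k]; [exact H0|].
assert (Eu := Hu (S k) ltac:(lia)); assert (Ev := Hv (S k) ltac:(lia)).
rewrite tech5, Nat.sub_diag, Hd in Eu, Ev.
rewrite (sum_eq _ (fun j => v j * d (S k - j)%nat)) in Eu; [lra|].
intros j Hj; rewrite IH by lia; reflexivity.
Qed.

Lemma sum_f_R0_even (f : nat -> R) (k : nat) :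
  (forall j, (j < k)%nat -> f (2 * j + 1)%nat = 0) ->
  sum_f_R0 f (2 * k) = sum_f_R0 (fun j => f (2 * j)%nat) k.
Proof.
intros Hf; induction k as [|k IH]; [reflexivity|].
replace (2 * S k)%nat with (S (S (2 * k))) by lia.
rewrite !tech5, IH by (intros j Hj; apply Hf; lia).
replace (2 * S k)%nat with (S (S (2 * k))) by lia.
replace (S (2 * k)) with (2 * k + 1)%nat at 1 by lia.
rewrite Hf by lia; ring.
Qed.

Lemma cosh_coef_even (j : nat) : cosh_coef (2 * j) = / INR (fact (2 * j)).
Proof. unfold cosh_coef; rewrite pow_1_even; field; apply INR_fact_neq_0. Qed.

Lemma cosh_coef_odd (j : nat) : cosh_coef (2 * j + 1) = 0.
Proof.
unfold cosh_coef; replace (2 * j + 1)%nat with (S (2 * j)) by lia.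
rewrite pow_1_odd; unfold Rdiv; ring.
Qed.

Lemma CV_radius_cosh_coef : Rbar_le 1 (CV_radius cosh_coef).
Proof.
apply (CV_radius_ge _ _ 1); intros n; rewrite pow1, Rmult_1_r.
apply cosh_coef_bound.
Qed.

Lemma cosh_pos (x : R) : 0 < cosh x.
Proof. unfold cosh; generalize (exp_pos x) (exp_pos (- x)); lra. Qed.

Lemma is_pseries_one (x : R) :
  is_pseries (fun n => match n with O => 1 | S _ => 0 end) x 1.
Proof.
apply is_pseries_R.
eapply is_series_Rext with
  (f := fun n => match n with O => 1 | S _ => 0 end); [|intros [|n]; simpl; ring|reflexivity].
apply is_series_Reals; apply is_lim_seq_Reals.
apply is_lim_seq_ext with (fun _ => 1); [|apply is_lim_seq_const].
intros n; induction n as [|n IH]; [reflexivity|].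
rewrite tech5, <- IH; ring.
Qed.

(** The product series represents [/ cosh x * cosh x = 1] near 0, and the coefficients of a power
    series are determined by its values there. *)
Lemma euler_cosh_convolution (E : nat -> R) :
  is_euler_numbers E -> forall n,
  PS_mult (fun k => E k / INR (fact k)) cosh_coef n
  = match n with O => 1 | S _ => 0 end.
Proof.
intros HE n; set (a := fun k => E k / INR (fact k)).
assert (Ha : Rbar_lt 0 (CV_radius a)) by exact (CV_radius_pos a _ HE).
(* The radius of [a] could be infinite and that of [cosh_coef] is only known to be at least 1, so a
   finite [r <= 1] is chosen inside both. *)
assert (Hr : exists r : posreal, Rbar_le r (CV_radius a) /\ r <= 1).
{ destruct (CV_radius a) as [r| |]; [|exists (mkposreal 1 Rlt_0_1); simpl; split; [exact I|lra]|easy].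
  simpl in Ha.
  exists (mkposreal (Rmin r 1) (Rmin_glb_lt _ _ _ Ha Rlt_0_1)); simpl.
  split; [apply Rmin_l|apply Rmin_r]. }
destruct Hr as [r [Hr Hr1]].
assert (Hloc : locally 0 (fun x : R => is_pseries (PS_mult a cosh_coef) x 1)).
{ assert (Hball : locally 0 (fun x : R => Rabs x < r)).
  { exists r; intros x Hx; unfold ball in Hx; simpl in Hx.
    unfold AbsRing_ball, abs, minus, plus, opp in Hx; simpl in Hx.
    rewrite Ropp_0, Rplus_0_r in Hx; exact Hx. }
  generalize (filter_and _ _ HE Hball); apply filter_imp; intros x [Hx Hxr].
  replace 1 with (/ cosh x * cosh x) by (field; generalize (cosh_pos x); lra).
  apply is_pseries_mult; [exact Hx|apply is_pseries_cosh| |].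
  - apply Rbar_lt_le_trans with r; [exact Hxr|exact Hr].
  - apply Rbar_lt_le_trans with 1; [simpl; lra|apply CV_radius_cosh_coef]. }
apply (PSeries_ext_recip (PS_mult a cosh_coef) (fun n => match n with O => 1 | S _ => 0 end)).
- exact (CV_radius_pos _ (fun _ => 1) Hloc).
- apply (CV_radius_pos _ (fun _ => 1)), filter_forall, is_pseries_one.
- revert Hloc; apply filter_imp; intros x Hx.
  transitivity 1; [exact (is_pseries_unique _ _ _ Hx)|].
  symmetry; exact (is_pseries_unique _ _ _ (is_pseries_one x)).
Qed.

Lemma beta_euler (E : nat -> R) (k : nat) :
  is_euler_numbers E ->
  beta k = Rabs (E (2 * k)%nat) / INR (fact (2 * k)) * PI ^ (2 * k + 1) / 2 ^ (2 * k + 2).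
Proof.
intros HE; assert (HP := PI_RGT_0).
assert (Hconv := euler_cosh_convolution E HE).
set (a := fun j => E j / INR (fact j)) in Hconv.
(* The factor [(2 / PI) ^ (2 * j)] strips the powers of [PI / 2] from the recurrence, leaving the
   coefficients of [cosh], and [4 / PI] normalises [beta 0] to 1. *)
assert (H : 4 / PI * ((-1) ^ k * (2 / PI) ^ (2 * k) * beta k) = a (2 * k)%nat).
{ apply (reciprocal_unique (fun j => / INR (fact (2 * j)))
    (fun j => 4 / PI * ((-1) ^ j * (2 / PI) ^ (2 * j) * beta j)) (fun j => a (2 * j)%nat)).
  - simpl; field.
  - cbv beta; rewrite beta_0; transitivity 1; [simpl; field; lra|].
    symmetry; rewrite <- (Hconv 0%nat); unfold PS_mult, cosh_coef; simpl; field.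
  - intros n Hn.
    rewrite (sum_eq _ (fun j => (-1) ^ j * ((PI / 2) ^ (2 * (n - j))
      / INR (fact (2 * (n - j)))) * beta j * (4 / PI * (2 / PI) ^ (2 * n)))).
    + rewrite <- scal_sum, beta_recurrence by exact Hn; ring.
    + intros j Hj; replace (2 * n)%nat with (2 * j + 2 * (n - j))%nat by lia.
      rewrite pow_add.
      assert (Hone : (PI / 2) ^ (2 * (n - j)) * (2 / PI) ^ (2 * (n - j)) = 1).
      { rewrite <- Rpow_mult_distr; replace (PI / 2 * (2 / PI)) with 1 by (field; lra).
        apply pow1. }
      transitivity ((-1) ^ j * (2 / PI) ^ (2 * j) * beta j * (4 / PI)
        * / INR (fact (2 * (n - j)))
        * ((PI / 2) ^ (2 * (n - j)) * (2 / PI) ^ (2 * (n - j)))); [rewrite Hone|];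
        unfold Rdiv; ring.
  - intros n Hn; assert (Hn2 := Hconv (2 * n)%nat).
    unfold PS_mult in Hn2; rewrite sum_f_R0_even in Hn2.
    + transitivity (match (2 * n)%nat with O => 1 | S _ => 0 end);
        [|destruct n; [lia|reflexivity]].
      rewrite <- Hn2; apply sum_eq; intros j Hj.
      replace (2 * n - 2 * j)%nat with (2 * (n - j))%nat by lia.
      now rewrite cosh_coef_even.
    (* An odd index of [E] meets an odd index of [cosh_coef], which vanishes. *)
    + intros j Hj.
      replace (2 * n - (2 * j + 1))%nat with (2 * (n - j - 1) + 1)%nat by lia.
      rewrite cosh_coef_odd; ring. }
assert (HF := INR_fact_lt_0 (2 * k)); assert (Hb := beta_nonneg k).
assert (H2 : 0 < 2 ^ (2 * k)) by (apply pow_lt; lra).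
assert (HPk : 0 < PI ^ (2 * k)) by (apply pow_lt; lra).
assert (H' : Rabs (E (2 * k)%nat) / INR (fact (2 * k))
             = 4 / PI * ((2 / PI) ^ (2 * k) * beta k)).
{ transitivity (Rabs (a (2 * k)%nat)).
  - unfold a, Rdiv; rewrite Rabs_mult, Rabs_inv, (Rabs_pos_eq (INR _)); lra.
  - rewrite <- H, !Rabs_mult, pow_1_abs.
    rewrite (Rabs_pos_eq (4 / PI)), (Rabs_pos_eq (beta k)), (Rabs_pos_eq (_ ^ _)).
    + ring.
    + apply pow_le; left; apply Rdiv_lt_0_compat; lra.
    + exact Hb.
    + left; apply Rdiv_lt_0_compat; lra. }
rewrite H', !pow_add.
replace ((2 / PI) ^ (2 * k)) with (2 ^ (2 * k) / PI ^ (2 * k))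
  by (unfold Rdiv; now rewrite Rpow_mult_distr, pow_inv).
field; lra.
Qed.

(** * Assembly of the series *)

Theorem theorem2
  (t b : nat -> Z) (E : nat -> R)
  (ht : is_thue_morse t) (hb : is_paperfolding b) (hE : is_euler_numbers E)
  (k : nat) (hk : (1 <= k)%nat) :
  is_series
    (fun n : nat => N_coef t b (S n) k / INR (S n) ^ (2 * k + 1))
    (zeta (INR (2 * k + 1))
     - 2 ^ (2 * k - 1) * Rabs (E (2 * k)%nat) / INR (fact (2 * k)) * PI ^ (2 * k + 1)).
Proof.
assert (Hs : (2 <= 2 * k + 1)%nat) by lia.
assert (Hp := is_series_paperfolding b _ _ hb Hs (is_series_beta k)).
assert (Hz := thue_morse_dirichlet t _ ht Hs).
assert (Ht : forall n, Rabs (IZR (t n)) <= 1) by exact (Rabs_thue_morse_le_1 t ht).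
assert (HA := is_series_dirichlet (fun n => IZR (t (n - 1)%nat)) 1 _ (fun n => Ht _) Hs).
assert (HB := is_series_dirichlet (fun n => IZR (t n)) 1 _ Ht Hs).
assert (H2 : 1 < 2 ^ (2 * k + 1)) by (apply Rlt_pow_R1; [lra|lia]).
eapply is_series_Rext.
- apply is_series_Rplus.
  + exact (is_series_Rmult_l (2 ^ (4 * k + 1) - 2 ^ (2 * k)) _ _ Hp).
  + apply (is_series_Rmult_l (/ 2 ^ (2 * k + 1))), is_series_Rplus.
    * exact (is_series_Rmult_l (2 ^ (2 * k + 1) + 1) _ _ HA).
    * exact (is_series_Rmult_l (2 ^ (2 * k + 1) - 1) _ _ HB).
- intros n; unfold N_coef; cbv beta; unfold Rdiv; ring.
(* The factor [2 ^ (4k+1) - 2 ^ (2k)] equals [2 ^ (2k) * (2 ^ (2k+1) - 1)] and clears the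
   denominator of the paperfolding part, leaving [- 2 ^ (4k+1) * beta k]; dividing by [2 ^ (2k+2)]
   gives the power [2 ^ (2k-1)]. *)
- rewrite Hz, zeta_dirichlet, (beta_euler E k hE).
  assert (HF := INR_fact_lt_0 (2 * k)).
  replace (2 ^ (4 * k + 1)) with (2 ^ (2 * k) * 2 ^ (2 * k + 1))
    by (rewrite <- pow_add; f_equal; lia).
  replace (2 ^ (2 * k + 2)) with (2 * 2 ^ (2 * k + 1))
    by (rewrite <- (pow_1 2) at 1; rewrite <- pow_add; f_equal; lia).
  replace (2 ^ (2 * k)) with (2 * 2 ^ (2 * k - 1))
    by (rewrite <- (pow_1 2) at 1; rewrite <- pow_add; f_equal; lia).
  field; lra.
Qed.
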